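(* Let $d\in\mathbb{N}$. (i) For every $\mathbf{r}\in\mathbb{R}^d$ we have $\mathbf{r}\in P_{\mathbf{r}}$, and $\mathbf{r}\in\mathcal{D}_d^{(0)}$ if and only if $P_{\mathbf{r}}\subseteq\mathcal{D}_d^{(0)}$. (ii) $\mathcal{D}_d^{(0)}=\bigcup\{P_{\mathbf{r}}\mid\mathbf{r}\in\mathcal{D}_d^{(0)}\}$, and this union is disjoint, i.e. any two distinct members of the set $\{P_{\mathbf{r}}\mid\mathbf{r}\in\mathcal{D}_d^{(0)}\}$ are disjoint.
   Context: $\mathbb{N}$ is the set of positive integers, $\mathbb{N}_0=\mathbb{N}\cup\{0\}$. For $\mathbf{r}\in\mathbb{R}^d$ and $\mathbf{a}=(a_1,\ldots,a_d)\in\mathbb{Z}^d$, $\mathbf{r}\mathbf{a}$ denotes the standard inner product, and $\tau_{\mathbf{r}}:\mathbb{Z}^d\to\mathbb{Z}^d$ is $\tau_{\mathbf{r}}(\mathbf{a})=(a_2,\ldots,a_d,-\lfloor\mathbf{r}\mathbf{a}\rfloor)$. Put $\tau_{\mathbf{r}}^\star(\mathbf{a}):=-\tau_{\mathbf{r}}(-\mathbf{a})$. Define $$\mathcal{D}_d^{(0)}:=\{\mathbf{r}\in\mathbb{R}^d\mid\forall\mathbf{a}\in\mathbb{Z}^d\ \exists n\in\mathbb{N}:\tau_{\mathbf{r}}^n(\mathbf{a})=\mathbf{0}\}.$$ For $\mathbf{r}\in\mathbb{R}^d$ the set of witnesses $V_{\mathbf{r}}\subseteq\mathbb{Z}^d$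 is $V_{\mathbf{r}}:=\bigcup_{n\in\mathbb{N}_0}V_n$, where $V_0:=\{(\pm1,0,\ldots,0),\ldots,(0,\ldots,0,\pm1)\}$ and $V_n:=V_{n-1}\cup\tau_{\mathbf{r}}(V_{n-1})\cup\tau_{\mathbf{r}}^\star(V_{n-1})$ for $n\in\mathbb{N}$. Finally $$P_{\mathbf{r}}:=\{\mathbf{s}\in\mathbb{R}^d\mid\forall\mathbf{a}\in V_{\mathbf{r}}:\ \tau_{\mathbf{s}}(\mathbf{a})=\tau_{\mathbf{r}}(\mathbf{a})\ \wedge\ \tau_{\mathbf{s}}^\star(\mathbf{a})=\tau_{\mathbf{r}}^\star(\mathbf{a})\}.$$ *)

(* Defs.v *)
From mathcomp Require Import all_boot all_order all_algebra archimedean.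
From mathcomp Require Import boolp classical_sets reals.

Set Implicit Arguments.
Unset Strict Implicit.
Unset Printing Implicit Defensive.

Import Order.TTheory GRing.Theory Num.Theory.

Local Open Scope classical_set_scope.
Local Open Scope ring_scope.

Definition inner (R : realType) (d : nat) (r : 'rV[R]_d) (a : 'rV[int]_d) : R :=
  \sum_(i < d) r 0 i * (a 0 i)%:~R.

(* tau r a = (a_2, ..., a_d, - floor (r a)): [insub i.+1] is the next index
   in ['I_d], and is [None] exactly when [i] is the last index. *)
Definition tau (R : realType) (d : nat) (r : 'rV[R]_d) (a : 'rV[int]_d) :
    'rV[int]_d :=
  \row_(i < d) if insub i.+1 is Some j then a 0 (j : 'I_d)
               else - Num.floor (inner r a).

Definition tau_star (R : realType) (d : nat) (r : 'rV[R]_d) (a : 'rV[int]_d) :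
    'rV[int]_d :=
  - tau r (- a).

Definition D0 (R : realType) (d : nat) : set 'rV[R]_d :=
  [set r | forall a : 'rV[int]_d, exists n : nat,
             (0 < n)%N /\ iter n (tau r) a = 0].

Arguments D0 : clear implicits.

Fixpoint witness_stage (R : realType) (d : nat) (r : 'rV[R]_d) (n : nat) :
    set 'rV[int]_d :=
  if n is m.+1 then
    witness_stage r m `|` tau r @` witness_stage r m
                      `|` tau_star r @` witness_stage r m
  else [set a | exists i : 'I_d, a = delta_mx 0 i \/ a = - delta_mx 0 i].

Definition witnesses (R : realType) (d : nat) (r : 'rV[R]_d) :
    set 'rV[int]_d :=
  \bigcup_n witness_stage r n.

Definition P_set (R : realType) (d : nat) (r : 'rV[R]_d) : set 'rV[R]_d :=
  [set s | forall a : 'rV[int]_d, witnesses r a ->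
             tau s a = tau r a /\ tau_star s a = tau_star r a].

(* Main.v *)
Require Import Defs.
From mathcomp Require Import all_boot all_order all_algebra archimedean.
From mathcomp Require Import boolp classical_sets reals.
From mathcomp Require Import lra.

Set Implicit Arguments.
Unset Strict Implicit.
Unset Printing Implicit Defensive.

Import Order.TTheory GRing.Theory Num.Theory.

Local Open Scope classical_set_scope.
Local Open Scope ring_scope.

(** The heart of the matter is that a witness set decides membership in [D0]
    (Brunotte's criterion). Since [floor (x + y)] exceeds [floor x] by either
    [floor y] or [ceil y], the map [tau s] is additive up to replacing [tau] by
    [tau_star] on one summand ([tau_add]). Hence perturbing a starting point by
    a witness perturbs each point of its orbit by a witness
    ([iter_tau_add_witness]). If the orbit of [a] under [tau s] reaches 0, then
    that of [a + v], with [v] a witness, reaches some witness [v']; and if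
    every witness is itself driven to 0, so is [a + v]. The signed unit vectors
    are witnesses and generate the lattice, so every point is driven to 0
    ([D0_witnesses]).

    When [s] lies in [P_set r], the maps [tau] and [tau_star] of [s] and [r]
    agree along the whole construction of the witnesses, so [s] and [r] have
    the same witnesses ([P_set_witnesses]), on which they have the same
    dynamics. The criterion then transports [D0] from [r] to [s], which gives
    (i). Equal witness sets with equal dynamics also yield [P_set s = P_set r]:
    the sets [P_set r] are the classes of an equivalence relation, which gives
    (ii). *)

Section Witnesses.

Variables (R : realType) (d : nat).
Implicit Types (r s : 'rV[R]_d) (a b v : 'rV[int]_d).

Lemma innerD r a b : inner r (a + b) = inner r a + inner r b.
Proof.
rewrite /inner -big_split; apply: eq_bigr => i _ /=.
by rewrite mxE intrD mulrDr.
Qed.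

Lemma innerN r a : inner r (- a) = - inner r a.
Proof.
rewrite /inner -sumrN; apply: eq_bigr => i _ /=.
by rewrite mxE intrN mulrN.
Qed.

Lemma inner0 r : inner r 0 = 0.
Proof. by rewrite /inner big1 // => i _; rewrite mxE mulr0. Qed.

Lemma floorD_floor_or_ceil (x y : R) :
  Num.floor (x + y) = Num.floor x + Num.floor y \/
  Num.floor (x + y) = Num.floor x - Num.floor (- y).
Proof.
have [lex ltx] := andP (floor_itv x).
have [ley lty] := andP (floor_itv y).
have [leN ltN] := andP (floor_itv (- y)).
case: (ltP (x + y) (Num.floor x + Num.floor y + 1)%:~R) => H; [left | right].
  by apply: floor_def; rewrite H intrD lerD.
apply: floor_def; apply/andP; split.
  (* The integer [- floor (- y)] is less than [y + 1], hence at most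
     [floor y + 1]. *)
  apply: le_trans H; rewrite ler_int -addrA lerD2l -ltzD1.
  rewrite -(ltr_int R) !intrD intrN.
  rewrite intrD in ltN lty.
  by lra.
rewrite !intrD intrN; rewrite intrD in ltx; lra.
Qed.

(** [tau_star] acts on the last coordinate with the ceiling where [tau] uses
    the floor, so the two cases are those of [floorD_floor_or_ceil]. *)
Lemma tau_add s a v :
  tau s (a + v) = tau s a + tau s v \/ tau s (a + v) = tau s a + tau_star s v.
Proof.
case: (floorD_floor_or_ceil (inner s a) (inner s v)) => H; [left | right];
  apply/rowP => i; rewrite !mxE; case: insub => [j|]; rewrite ?mxE ?opprK //.
- by rewrite innerD H opprD.
- by rewrite innerD innerN H opprD opprK.
Qed.

Lemma tau0 s : tau s 0 = 0.
Proof.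
apply/rowP => i; rewrite !mxE; case: insub => [j|]; rewrite ?mxE //.
by rewrite inner0 floor0 oppr0.
Qed.

Lemma witnesses_tau r v : witnesses r v -> witnesses r (tau r v).
Proof. by move=> [n _ vn]; exists n.+1 => //=; left; right; exists v. Qed.

Lemma witnesses_tau_star r v : witnesses r v -> witnesses r (tau_star r v).
Proof. by move=> [n _ vn]; exists n.+1 => //=; right; exists v. Qed.

Lemma witnesses_delta r (i : 'I_d) :
  witnesses r (delta_mx 0 i) /\ witnesses r (- delta_mx 0 i).
Proof. by split; exists 0%N => //; exists i; [left | right]. Qed.

Lemma iter_tau_add_witness s n a v : witnesses s v ->
  exists2 v', witnesses s v' & iter n (tau s) (a + v) = iter n (tau s) a + v'.
Proof.
move=> Vv; elim: n => [|n [v' Vv' E]]; first by exists v.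
rewrite !iterS E; case: (tau_add s (iter n (tau s) a) v') => ->.
- by exists (tau s v') => //; exact: witnesses_tau.
- by exists (tau_star s v') => //; exact: witnesses_tau_star.
Qed.

Lemma int_row_ind (Q : 'rV[int]_d -> Prop) : Q 0 ->
  (forall a i, Q a -> Q (a + delta_mx 0 i) /\ Q (a - delta_mx 0 i)) ->
  forall a, Q a.
Proof.
move=> Q0 Qstep a.
(* Translations that preserve [Q] are closed under addition, so it suffices to
   treat multiples of unit vectors. *)
suff: forall b, Q b -> Q (b + a) by move=> /(_ 0 Q0); rewrite add0r.
rewrite (row_sum_delta a).
apply: (big_ind (fun x => forall b, Q b -> Q (b + x))).
- by move=> b; rewrite addr0.
- by move=> x y Qx Qy b Qb; rewrite addrA; apply/Qy/Qx.
move=> i _ b Qb; rewrite -[a 0 i]intz scaler_int.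
elim/int_ind: (a 0 i) => [|n IH|n IH]; first by rewrite addr0.
- by rewrite intS [1 + _]addrC mulrzDr addrA; case: (Qstep _ i IH).
- by rewrite intS [1 + _]addrC opprD mulrzDr addrA; case: (Qstep _ i IH).
Qed.

(** Brunotte's criterion: it suffices to follow the orbits of the witnesses. *)
Lemma D0_witnesses s :
  (forall v, witnesses s v -> exists n, (0 < n)%N /\ iter n (tau s) v = 0) ->
  D0 R d s.
Proof.
move=> V0; apply: int_row_ind; first by exists 1%N; rewrite /= tau0.
have step a v : witnesses s v ->
    (exists n, (0 < n)%N /\ iter n (tau s) a = 0) ->
    exists n, (0 < n)%N /\ iter n (tau s) (a + v) = 0.
  move=> Vv [n [_ an0]]; have [v' Vv' E] := iter_tau_add_witness n a Vv.
  have [m [m_gt0 v'm0]] := V0 _ Vv'; exists (m + n)%N.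
  by rewrite addn_gt0 m_gt0 iterD E an0 add0r.
by move=> a i a0; case: (witnesses_delta s i) => Vp Vm; split; apply: step.
Qed.

Lemma P_set_refl r : P_set r r.
Proof. by []. Qed.

(** By induction on stages: each new stage is obtained by applying, to earlier
    witnesses of [r], maps on which [s] and [r] agree. *)
Lemma P_set_witnesses r s : P_set r s -> witnesses s = witnesses r.
Proof.
move=> Prs; rewrite /witnesses; apply: eq_bigcupr => n _.
elim: n => [//|n IH] /=; rewrite IH.
have agree v : witness_stage r n v ->
    tau s v = tau r v /\ tau_star s v = tau_star r v.
  by move=> vn; apply: Prs; exists n.
congr (_ `|` _ `|` _); apply: eq_imagel => v vn; by case: (agree v vn).
Qed.

Lemma P_set_eq r s : P_set r s -> P_set s = P_set r.
Proof.
move=> Prs; have Vsr := P_set_witnesses Prs.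
apply/seteqP; split => t Pt v; rewrite -?Vsr => Vv.
- by have [-> ->] := Pt v Vv; apply: Prs; rewrite -Vsr.
- by rewrite Vsr in Vv; have [-> ->] := Pt v Vv; have [-> ->] := Prs v Vv.
Qed.

Lemma P_set_iter_tau r s n v : P_set r s -> witnesses r v ->
  iter n (tau s) v = iter n (tau r) v.
Proof.
move=> Prs; elim: n v => [//|n IH] v Vv; rewrite !iterSr.
by have [-> _] := Prs v Vv; apply/IH/witnesses_tau.
Qed.

Lemma P_set_sub_D0 r : D0 R d r -> P_set r `<=` D0 R d.
Proof.
move=> Dr s Prs; apply: D0_witnesses => v.
rewrite (P_set_witnesses Prs) => Vv; have [n [n_gt0 vn0]] := Dr v.
by exists n; rewrite (P_set_iter_tau n Prs Vv).
Qed.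

End Witnesses.

Theorem proposition3p1 (R : realType) (d : nat) (d_gt0 : (0 < d)%N) :
  (forall r : 'rV[R]_d,
     P_set r r /\ (D0 R d r <-> P_set r `<=` D0 R d))
  /\
  (D0 R d
     = \bigcup_(A in [set P_set r | r in D0 R d]) A
   /\
   forall A B : set 'rV[R]_d,
     [set P_set r | r in D0 R d] A ->
     [set P_set r | r in D0 R d] B ->
     A <> B -> A `&` B = set0).
Proof.
split=> [r|].
  split; first exact: P_set_refl.
  split; first exact: P_set_sub_D0.
  by apply; exact: P_set_refl.
split.
  apply/seteqP; split => [r Dr | s [_ [r Dr <-]]].
    by exists (P_set r); [exists r | exact: P_set_refl].
  exact: P_set_sub_D0.
move=> _ _ [r _ <-] [s _ <-] neq; apply/seteqP; split=> // t [Prt Pst].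
by apply: neq; rewrite -(P_set_eq Prt) (P_set_eq Pst).
Qed.
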